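(* Let $A,B\in\mathcal{M}_n^{++}$ and let $0<h<k$ be scalars such that $hI\leq A\leq kI$ and $hI\leq B\leq kI$. Let $\mu>0$, let $0\leq\lambda\leq 1$, and put $t=\min\{\lambda,1-\lambda\}$, $k^*=(k+\mu)^{-1}$, $h^*=(h+\mu)^{-1}$ and $$C=\left(\frac{k^*\nabla_t h^*}{k^*\sharp_t h^*}\right)^{-1}.$$ Then $$\mathcal{R}_{\mu}(A,B,1-\lambda,\lambda)+\mu I\ \geq\ C\,\big(A\sharp_{\lambda}B+\mu I\big).$$
   Context: $\mathcal{M}_n$ is the algebra of $n\times n$ complex matrices, $I$ the identity, and $\mathcal{M}_n^{++}$ the set of positive definite matrices. For Hermitian $X,Y$, $X\geq Y$ means that $X-Y$ is positive semi-definite (Loewner order). The resolvent average of $A,B$ with weights $(1-\lambda,\lambda)$ and parameter $\mu$ is $$\mathcal{R}_{\mu}(A,B,1-\lambda,\lambda)=\big((1-\lambda)(A+\mu I)^{-1}+\lambda(B+\mu I)^{-1}\big)^{-1}-\mu I .$$ The weighted geometric mean is $A\sharp_{\lambda}B=A^{1/2}(A^{-1/2}BA^{-1/2})^{\lambda}A^{1/2}$. For positive scalars $a,b$ and $t\in[0,1]$: $a\nabla_t b=(1-t)a+tb$ and $a\sharp_t b=a^{1-t}b^{t}$. *)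

(* Defs.v *)
From mathcomp Require Import all_boot all_order all_algebra.
From mathcomp Require Import reals exp.
From mathcomp Require Import complex.

Set Implicit Arguments.
Unset Strict Implicit.
Unset Printing Implicit Defensive.

Import Order.TTheory GRing.Theory Num.Theory.
Local Open Scope ring_scope.
Local Open Scope complex_scope.
Local Open Scope sesquilinear_scope.

Section MatrixMeans.
Context {R : realType} {n : nat}.
Implicit Types (A B X Y : 'M[R[i]]_n) (u : 'cV[R[i]]_n) (p m s : R).

(* In R[i] the order is partial: 0 <= z and 0 < z entail that z is real. *)
Definition psdmx A : Prop :=
  A \is hermsymmx /\ forall u, 0 <= (u ^t* *m A *m u) 0 0.

Definition posdefmx A : Prop :=
  A \is hermsymmx /\ forall u, u != 0 -> 0 < (u ^t* *m A *m u) 0 0.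

Definition loewner_ge X Y : Prop := psdmx (X - Y).

(* Real power of a positive definite matrix by functional calculus:
   A = P^-1 D P with P unitary and D diagonal (orthomx_spectralP), and the
   eigenvalues in D are raised to the power p. They are real and positive when
   A is positive definite, so that taking their real part loses nothing; the
   value is a junk one on matrices that are not positive definite. *)
Definition powmx A p : 'M[R[i]]_n :=
  invmx (spectralmx A)
  *m diag_mx (map_mx (fun z : R[i] => (complex.Re z `^ p)%:C) (spectral_diag A))
  *m spectralmx A.

(* [gmeanmx A B s] is A #_s B. *)
Definition gmeanmx A B s : 'M[R[i]]_n :=
  powmx A 2^-1
  *m powmx (powmx A (- 2^-1) *m B *m powmx A (- 2^-1)) s
  *m powmx A 2^-1.

(* [resolvent_avg m A B v w] is R_m(A, B, v, w), with v the weight of A and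
   w that of B. *)
Definition resolvent_avg m A B (v w : R) : 'M[R[i]]_n :=
  invmx (v%:C *: invmx (A + m%:C%:M) + w%:C *: invmx (B + m%:C%:M)) - m%:C%:M.

End MatrixMeans.

Definition amean {R : realType} (a b s : R) : R := (1 - s) * a + s * b.

Definition gmean {R : realType} (a b s : R) : R := a `^ (1 - s) * b `^ s.

(* Main.v *)
(** With A' = A + mu and B' = B + mu, write A' = Y Y^*, B' = Y diag(y) Y^*
    for an invertible Y.  In this frame both the harmonic mean of A' and B' and
    A' #_lambda B' are diagonal, so that the reverse Young inequality
      R_mu(A, B) + mu >= C (A' #_lambda B')
    is the scalar inequality
      (1 - lambda) y^lambda + lambda y^(lambda - 1) <= 1 / C
    for the entries of y, which lie in [(h + mu)/(k + mu), (k + mu)/(h + mu)].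
    The left-hand side is convex in ln y, and at the endpoints it is controlled
    by the convexity of sinh.

    It remains to see that A' #_lambda B' >= A #_lambda B + mu, an instance of
    the superadditivity of the geometric mean.  In frames, superadditivity
    says that X X^* = Y Y^* and X diag(x) X^* = Y diag(y) Y^*, with X possibly
    rectangular, imply X diag(x^p) X^* <= Y diag(y^p) Y^* for p in [0, 1].
    The set of such p is closed and contains 0 and 1, and it is closed under
    midpoints by operator monotonicity of the square root, hence it is all of
    [0, 1]. *)

Require Import Defs.
From HB Require Import structures.
From mathcomp Require Import all_boot all_order all_algebra.
From mathcomp Require Import boolp classical_sets interval_inference.
From mathcomp Require Import topology normedtype sequences convex.
From mathcomp Require Import reals exp.
From mathcomp Require Import complex ring lra.

Set Implicit Arguments.
Unset Strict Implicit.
Unset Printing Implicit Defensive.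

Import Order.TTheory GRing.Theory Num.Theory.
Import numFieldNormedType.Exports.
Local Open Scope ring_scope.
Local Open Scope complex_scope.
Local Open Scope sesquilinear_scope.

(* Locked, and with its type stated over R[i]: otherwise the ring structure on
   the entries of A^t* is found through numClosedFieldType, and unifying it with
   the one found on R[i] itself is prohibitively slow. *)
HB.lock Definition adjmx {R : realType} {m n} (A : 'M[R[i]]_(m, n)) :
  'M[R[i]]_(n, m) := A^t*.

Local Notation "A ^H" := (adjmx A) (at level 30, format "A ^H").

HB.lock Definition rdiag {R : realType} {n} (d : 'I_n -> R) : 'M[R[i]]_n :=
  diag_mx (\row_j (d j)%:C).

(** * Adjoints and positive semidefinite matrices *)

Section PositiveSemidefinite.
Context {R : realType}.
Local Notation C := R[i].

Lemma adjmxK m n (A : 'M[C]_(m, n)) : (A^H)^H = A.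
Proof. by rewrite adjmx.unlock trmxCK. Qed.

Lemma adjmxM m n p (A : 'M[C]_(m, n)) (B : 'M[C]_(n, p)) :
  (A *m B)^H = B^H *m A^H.
Proof. by rewrite adjmx.unlock trmx_mul map_mxM. Qed.

Lemma adjmxD m n (A B : 'M[C]_(m, n)) : (A + B)^H = A^H + B^H.
Proof. by rewrite adjmx.unlock linearD map_mxD. Qed.

Lemma adjmxB m n (A B : 'M[C]_(m, n)) : (A - B)^H = A^H - B^H.
Proof. by rewrite adjmx.unlock linearB map_mxB. Qed.

Lemma adjmxZ m n (c : R) (A : 'M[C]_(m, n)) : (c%:C *: A)^H = c%:C *: A^H.
Proof.
rewrite adjmx.unlock linearZ map_mxZ; congr (_ *: _).
by apply/CrealP; rewrite complex_real.
Qed.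

Lemma adjmx1 n : (1%:M : 'M[C]_n)^H = 1%:M.
Proof. by rewrite adjmx.unlock trmx1 map_mx1. Qed.

Lemma adjmx_scalar n (c : R) : (c%:C%:M : 'M[C]_n)^H = c%:C%:M.
Proof. by rewrite -scalemx1 adjmxZ adjmx1. Qed.

Lemma hermsymmxP n (A : 'M[C]_n) : reflect (A^H = A) (A \is hermsymmx).
Proof.
rewrite adjmx.unlock.
by apply: (iffP (is_hermitianmxP _ _ _)); rewrite expr0 scale1r => /esym.
Qed.

Lemma psdmxP n (A : 'M[C]_n) :
  psdmx A <-> A^H = A /\ forall u : 'cV_n, 0 <= (u^H *m A *m u) 0 0.
Proof.
split=> -[hA pA]; split; do ?[exact/hermsymmxP].
  by move=> u; have := pA u; rewrite adjmx.unlock.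
by move=> u; have := pA u; rewrite adjmx.unlock.
Qed.

Lemma psdmx_adj {n} {A : 'M[C]_n} : psdmx A -> A^H = A.
Proof. by case/psdmxP. Qed.

Lemma psdmxD n (A B : 'M[C]_n) : psdmx A -> psdmx B -> psdmx (A + B).
Proof.
move=> /psdmxP[hA pA] /psdmxP[hB pB]; apply/psdmxP; split=> [|u].
  by rewrite adjmxD hA hB.
by rewrite mulmxDr mulmxDl mxE addr_ge0.
Qed.

Lemma psdmxZ n (c : R) (A : 'M[C]_n) : 0 <= c -> psdmx A -> psdmx (c%:C *: A).
Proof.
move=> c0 /psdmxP[hA pA]; apply/psdmxP; split=> [|u].
  by rewrite adjmxZ hA.
by rewrite -scalemxAr -scalemxAl mxE mulr_ge0 ?ler0c.
Qed.

Lemma psdmx_congr m n (X : 'M[C]_(m, n)) (A : 'M[C]_n) :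
  psdmx A -> psdmx (X *m A *m X^H).
Proof.
move=> /psdmxP[hA pA]; apply/psdmxP; split=> [|u].
  by rewrite !adjmxM adjmxK hA mulmxA.
have := pA (X^H *m u); rewrite adjmxM adjmxK.
by rewrite !mulmxA.
Qed.

Lemma psdmx_congrB m n (X : 'M[C]_(m, n)) (A B : 'M[C]_n) (A' B' : 'M[C]_m) :
  X *m A *m X^H = A' -> X *m B *m X^H = B' ->
  psdmx (A - B) -> psdmx (A' - B').
Proof.
by move=> <- <- /(psdmx_congr X); rewrite (mulmxBr X A B) mulmxBl.
Qed.

Lemma formmxB n (A B : 'M[C]_n) (u : 'cV[C]_n) :
  (u^H *m (A - B) *m u) 0 0 = (u^H *m A *m u) 0 0 - (u^H *m B *m u) 0 0.
Proof.
rewrite (mulmxBr (u^H) A B) mulmxBl.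
by move: (u^H *m A *m u) (u^H *m B *m u) => a b; rewrite !mxE.
Qed.

Lemma psdmx1 n : psdmx (1%:M : 'M[C]_n).
Proof.
apply/psdmxP; split=> [|u]; first exact: adjmx1.
rewrite mulmx1 adjmx.unlock mxE sumr_ge0// => j _; rewrite !mxE mulrC.
exact: mul_conjC_ge0.
Qed.

Lemma form1_gt0 n (u : 'cV[C]_n) : u != 0 -> 0 < (u^H *m u) 0 0.
Proof.
move=> u0; rewrite lt_neqAle; apply/andP; split; last first.
  by have /psdmxP[_ /(_ u)] := psdmx1 n; rewrite mulmx1.
rewrite eq_sym; apply: contra u0 => /eqP uu0; apply/eqP/matrixP => j k.
rewrite (ord1 k) [RHS]mxE; move: uu0; rewrite adjmx.unlock mxE => /eqP.
rewrite psumr_eq0 => [/allP/(_ j)|i _]; last first.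
  by rewrite !mxE -normCKC exprn_ge0.
rewrite mem_index_enum !mxE -normCKC => /(_ isT).
by rewrite expf_eq0/= normr_eq0 => /eqP.
Qed.

Lemma psdmx_gram m n (X : 'M[C]_(m, n)) : psdmx (X *m X^H).
Proof. by rewrite -[X in X *m _]mulmx1; exact/psdmx_congr/psdmx1. Qed.

Lemma eq_rdiag n (d e : 'I_n -> R) : d =1 e -> rdiag d = rdiag e.
Proof. by move=> /funext ->. Qed.

Lemma rdiagM n (d e : 'I_n -> R) :
  rdiag d *m rdiag e = rdiag (fun j => d j * e j).
Proof.
rewrite rdiag.unlock mulmx_diag; congr diag_mx; apply/rowP => j.
by rewrite !mxE rmorphM.
Qed.

Lemma rdiagD n (d e : 'I_n -> R) :
  rdiag d + rdiag e = rdiag (fun j => d j + e j).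
Proof.
rewrite rdiag.unlock -raddfD /=; congr diag_mx; apply/rowP => j.
by rewrite !mxE rmorphD.
Qed.

Lemma rdiagZ n c (d : 'I_n -> R) :
  c%:C *: rdiag d = rdiag (fun j => c * d j).
Proof.
rewrite rdiag.unlock -linearZ /=; congr diag_mx; apply/rowP => j.
by rewrite !mxE rmorphM.
Qed.

Lemma rdiag1 n : rdiag (fun=> 1 : R) = 1%:M :> 'M[C]_n.
Proof.
rewrite rdiag.unlock -diag_const_mx; congr diag_mx; apply/rowP => j.
by rewrite !mxE rmorph1.
Qed.

Lemma adj_rdiag n (d : 'I_n -> R) : (rdiag d)^H = rdiag d.
Proof.
rewrite adjmx.unlock rdiag.unlock tr_diag_mx map_diag_mx.
congr diag_mx; apply/rowP => j.
by rewrite !mxE; apply/CrealP; rewrite complex_real.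
Qed.

Lemma mul_rdiag_adj m n (X : 'M[C]_(m, n)) (d e : 'I_n -> R) :
  X *m rdiag d *m (X *m rdiag e)^H = X *m rdiag (fun j => d j * e j) *m X^H.
Proof. by rewrite adjmxM adj_rdiag -rdiagM !mulmxA. Qed.

Lemma hermsymmx_rdiag m n (X : 'M[C]_(m, n)) (d : 'I_n -> R) :
  X *m rdiag d *m X^H \is hermsymmx.
Proof.
by apply/hermsymmxP; rewrite adjmxM adjmxK adjmxM adj_rdiag -mulmxA.
Qed.

(** Writing the squared modulus as Re^2 + Im^2 exhibits the form as an embedded real number, whose
    sign is decided in [R]. *)
Lemma rdiag_form n (d : 'I_n -> R) (u : 'cV[C]_n) :
  (u^H *m rdiag d *m u) 0 0 =
  (\sum_j (complex.Re (u j 0) ^+ 2 + complex.Im (u j 0) ^+ 2) * d j)%:C.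
Proof.
rewrite mxE rmorph_sum; apply: eq_bigr => j _.
rewrite adjmx.unlock rdiag.unlock mul_mx_diag !mxE rmorphM/=.
rewrite add_Re2_Im2 normCKC.
by rewrite mulrAC.
Qed.

Lemma psdmx_rdiag n (d : 'I_n -> R) : (forall j, 0 <= d j) -> psdmx (rdiag d).
Proof.
move=> d0; apply/psdmxP; split=> [|u]; first exact: adj_rdiag.
rewrite rdiag_form ler0c sumr_ge0// => j _.
by rewrite mulr_ge0// addr_ge0// sqr_ge0.
Qed.

Lemma psdmx_rdiag_ge0 n (d : 'I_n -> R) j : psdmx (rdiag d) -> 0 <= d j.
Proof.
move=> /psdmxP[_ /(_ (delta_mx j 0))]; rewrite rdiag_form ler0c.
rewrite (bigD1 j)//= big1.
  by rewrite !mxE !eqxx/= expr1n expr0n/= !addr0 mul1r.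
by move=> i /negPf ij; rewrite !mxE ij/= expr0n/= addr0 mul0r.
Qed.

Lemma psdmx_congr_inv n (W X A : 'M[C]_n) :
  W *m X = 1%:M -> psdmx (X *m A *m X^H) -> psdmx A.
Proof.
move=> WX /(psdmx_congr W); have XW : X^H *m W^H = 1%:M.
  by rewrite -adjmxM WX adjmx1.
by rewrite -!mulmxA XW mulmx1 mulmxA WX mul1mx.
Qed.

Lemma psdmx_congrB_inv n (W X A B A' B' : 'M[C]_n) : W *m X = 1%:M ->
  X *m A *m X^H = A' -> X *m B *m X^H = B' ->
  psdmx (A' - B') -> psdmx (A - B).
Proof.
move=> WX <- <- AB; apply: (psdmx_congr_inv WX).
by rewrite (mulmxBr X A B) mulmxBl.
Qed.

Lemma spectral_rdiag n (E : 'M[C]_n) : E \is hermsymmx ->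
  [/\ spectralmx E *m (spectralmx E)^H = 1%:M,
      invmx (spectralmx E) = (spectralmx E)^H &
      E = (spectralmx E)^H *m rdiag (fun j => complex.Re (spectral_diag E 0 j))
        *m spectralmx E].
Proof.
move=> hE; have /orthomx_spectralP EP := hermitian_normalmx hE.
have /invmx_unitary invP := spectral_unitarymx E.
rewrite adjmx.unlock; split=> //; first exact/unitarymxP/spectral_unitarymx.
rewrite {1}EP invP.
suff -> : diag_mx (spectral_diag E) =
          rdiag (fun j => complex.Re (spectral_diag E 0 j)) by [].
rewrite rdiag.unlock; congr diag_mx; apply/rowP => j; rewrite mxE RRe_real//.
by have /mxOverP := hermitian_spectral_diag_real hE; apply.
Qed.

(** In a unitary eigenbasis [E] is real diagonal, and the hypothesis applies to the columns of
    [P^H], which are eigenvectors. *)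
Lemma psdmx_eigenvalues n (E : 'M[C]_n) : E \is hermsymmx ->
  (forall (e : R) (w : 'cV_n), w != 0 -> E *m w = e%:C *: w -> 0 <= e) ->
  psdmx E.
Proof.
move=> /spectral_rdiag; set P := spectralmx E; set d := fun j => _.
move: P d => P d [PP _ ->] pE.
suff /(psdmx_congr (P^H)) : psdmx (rdiag d) by rewrite adjmxK.
apply: psdmx_rdiag => j; apply: (pE _ (P^H *m delta_mx j 0)).
  apply/eqP => /(congr1 (mulmx P)); rewrite mulmxA mulmx0 PP.
  rewrite mul1mx => /matrixP/(_ j 0); rewrite !mxE !eqxx => /eqP.
  by rewrite oner_eq0.
rewrite -!mulmxA [P *m (_ *m _)]mulmxA PP mul1mx scalemxAr.
congr (_ *m _); apply/matrixP => i k; rewrite rdiag.unlock mul_diag_mx !mxE.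
by case: eqP => [->//|_]; rewrite !mulr0.
Qed.

End PositiveSemidefinite.

(** * Operator monotonicity of the square root *)

Section SquareRoot.
Context {R : realType}.
Local Notation C := R[i].

(** If (D - N) w = e w with e < 0, then w^H (D^2 - N^2) w = |D w|^2 - |D w - e w|^2 = e (2 w^H D w -
    e |w|^2) is negative, since the bracket is positive: a contradiction. *)
Lemma psdmx_sqrt_mono n (N D : 'M[C]_n) : N \is hermsymmx -> psdmx D ->
  psdmx (D *m D - N *m N) -> psdmx (D - N).
Proof.
move=> /hermsymmxP hN pD pDN; have hD := psdmx_adj pD.
apply: psdmx_eigenvalues => [|e w w0 Ew].
  by apply/hermsymmxP; rewrite adjmxB hD hN.
have Nw : N *m w = D *m w - e%:C *: w by rewrite -Ew mulmxBl opprB addrC subrK.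
have wN : w^H *m N = w^H *m D - e%:C *: w^H.
  by rewrite -{1}hN -adjmxM Nw adjmxB adjmxM hD adjmxZ.
have form_ge0 : 0 <= e%:C * ((w^H *m D *m w) 0 0 *+ 2 - e%:C * (w^H *m w) 0 0).
  have /psdmxP[_ /(_ w)] := pDN.
  have -> : w^H *m (D *m D - N *m N) *m w =
      (w^H *m D) *m (D *m w) - (w^H *m N) *m (N *m w).
    by rewrite mulmxBr mulmxBl !mulmxA.
  rewrite wN Nw !mulmxBl !mulmxBr -!scalemxAr -!scalemxAl !mulmxA.
  move: (w^H *m D *m D *m w) (w^H *m D *m w) (w^H *m w) => a b c.
  by rewrite !mxE => H; apply: le_trans H _; rewrite le_eqVlt; apply/orP; left;
    apply/eqP; ring.
have /psdmxP[_ /(_ w) Dw_ge0] := pD.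
have ww_gt0 := form1_gt0 w0.
rewrite leNgt; apply/negP => e0.
have: 0 < (w^H *m D *m w) 0 0 *+ 2 - e%:C * (w^H *m w) 0 0.
  rewrite ltr_wpDl ?mulrn_wge0// -mulNr mulr_gt0// -rmorphN.
  by rewrite (ltcR 0) oppr_gt0.
by rewrite -(nmulr_rlt0 _ (_ : e%:C < 0)) ?(ltcR _ 0)// =>
  /(le_lt_trans form_ge0); rewrite ltxx.
Qed.

(** With N = T1 T2^H, monotonicity of the square root reduces the claim to N^2 <= D^2, and D^2 - N^2
    = (D^2 - T1 T1^H) + (T1 - N T2) (T1 - N T2)^H + N (1 - T2 T2^H) N^H. *)
Lemma psdmx_geom_mean n m (T1 T2 : 'M[C]_(n, m)) (D : 'M[C]_n) :
  T1 *m T2^H \is hermsymmx -> psdmx D ->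
  psdmx (D *m D - T1 *m T1^H) -> psdmx (1%:M - T2 *m T2^H) ->
  psdmx (D - T1 *m T2^H).
Proof.
move=> hN pD p1 p2; apply: (psdmx_sqrt_mono hN pD).
have /hermsymmxP hN' := hN; set N := T1 *m T2^H in hN' *.
have N' : T2 *m T1^H = N by rewrite -hN' adjmxM adjmxK.
suff -> : D *m D - N *m N = D *m D - T1 *m T1^H
    + ((T1 - N *m T2) *m (T1 - N *m T2)^H
    + N *m (1%:M - T2 *m T2^H) *m N^H).
  exact: psdmxD p1 (psdmxD (psdmx_gram _) (psdmx_congr _ p2)).
have -> : (T1 - N *m T2) *m (T1 - N *m T2)^H =
    T1 *m T1^H - N *m N - (N *m N - N *m (T2 *m T2^H) *m N).
  rewrite adjmxB adjmxM hN' mulmxBl !mulmxBr (mulmxA T1) -/N.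
  by rewrite -(mulmxA N T2 (T1^H)) N' !mulmxA.
have -> : N *m (1%:M - T2 *m T2^H) *m N^H =
    N *m N - N *m (T2 *m T2^H) *m N.
  by rewrite hN' mulmxBr mulmx1 mulmxBl.
by rewrite subrK addrA subrK.
Qed.

End SquareRoot.

(** * Midpoint-stable inequalities and continuity in the exponent *)

Section Midpoint.
Context {R : realType}.
Local Open Scope classical_set_scope.

(** Otherwise [p] lies in a gap of the closed set [G] of parameters satisfying all the inequalities,
    and the midpoint of the gap is again in [G]. The index lets the midpoint hypothesis use all
    inequalities together, as a matrix inequality is a family of scalar ones. *)
Lemma midpoint_ge0 (I : Type) (phi : I -> R -> R) :
  (forall i, continuous (phi i)) ->
  (forall i, 0 <= phi i 0) -> (forall i, 0 <= phi i 1) ->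
  (forall a b, 0 <= a <= 1 -> 0 <= b <= 1 -> (forall i, 0 <= phi i a) ->
    (forall i, 0 <= phi i b) ->
    forall i, 0 <= phi i ((a + b) / 2)) ->
  forall p, 0 <= p <= 1 -> forall i, 0 <= phi i p.
Proof.
move=> phic phi0 phi1 phim p /andP[p0 p1].
set G := [set q | forall i, 0 <= phi i q].
have Gc : closed G.
  have -> : G = \bigcap_i (phi i @^-1` [set x | 0 <= x]).
    by apply/seteqP; split => q /= Gq i; [move=> _; exact: Gq|exact: Gq].
  apply: closed_bigI => i _; apply: closed_comp => [x _|]; first exact: phic.
  exact: closed_ge.
apply: contrapT => nGp.
have sup_cl (E : set R) : closed E -> E !=set0 -> has_ubound E -> E (sup E).
  by move=> /closure_id {3}-> E0 ubE; exact: closure_sup.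
(* The ends of the gap: [sup L] is the last point of [G] up to [p], and [- sup U] the first one from
   [p] on. *)
pose L := G `&` [set q | q <= p].
pose U := (-%R @^-1` G) `&` [set q | q <= - p].
have ubL : has_ubound L by exists p => q [].
have ubU : has_ubound U by exists (- p) => q [].
have [Ga ap] : L (sup L).
  apply: sup_cl => //; last by exists 0.
  by apply: closedI => //; exact: closed_le.
have [Gb pb] : U (sup U).
  apply: sup_cl => //.
    apply: closedI; last exact: closed_le.
    by apply: closed_comp => // q _; exact: opp_continuous.
  by exists (-1); split => /=; rewrite ?opprK// lerN2.
move: Ga ap Gb pb => /= Ga ap Gb pb.
have {}ap : sup L < p.
  by rewrite lt_neqAle ap andbT; apply: contra_notN nGp => /eqP <-.
have {}pb : p < - sup U.
  rewrite ltrNr lt_neqAle pb andbT.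
  by apply: contra_notN nGp => /eqP eU; move: Gb; rewrite eU opprK.
have La : 0 <= sup L by apply: (ub_le_sup ubL).
have Ub : -1 <= sup U.
  by apply: (ub_le_sup ubU); split => /=; rewrite ?opprK// lerN2.
have Gm : G ((sup L - sup U) / 2) by apply: phim => //; apply/andP; split; lra.
have [mp|pm] := leP ((sup L - sup U) / 2) p.
  by have := ub_le_sup ubL (conj Gm mp : L _); lra.
have Um : U (- ((sup L - sup U) / 2)).
  by split => /=; [rewrite opprK|rewrite lerN2 ltW].
by have := ub_le_sup ubU Um; lra.
Qed.

Lemma continuous_powRr (x : R) : 0 < x -> continuous (powR x).
Proof.
move=> x0; rewrite /powR gt_eqF// => p.
apply: continuous_comp; last exact: continuous_expR.
exact: mulrr_continuous.
Qed.

End Midpoint.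

(** * Powers in congruent frames *)

Section Jensen.
Context {R : realType}.
Local Notation C := R[i].

Lemma powR_split (x a b c : R) : 0 < x -> a + b = c -> x `^ a * x `^ b = x `^ c.
Proof. by move=> x0 <-; rewrite powRD// (gt_eqF x0) implybT. Qed.

Lemma psdmx_powR_midpoint n m (X : 'M[C]_(n, m)) (Y W : 'M[C]_n)
    (x : 'I_m -> R) (y : 'I_n -> R) (a b : R) :
  W *m Y = 1%:M -> (forall j, 0 < x j) -> (forall j, 0 < y j) ->
  psdmx (Y *m rdiag (fun j => y j `^ a) *m Y^H
         - X *m rdiag (fun j => x j `^ a) *m X^H) ->
  psdmx (Y *m rdiag (fun j => y j `^ b) *m Y^H
         - X *m rdiag (fun j => x j `^ b) *m X^H) ->
  psdmx (Y *m rdiag (fun j => y j `^ ((a + b) / 2)) *m Y^H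
         - X *m rdiag (fun j => x j `^ ((a + b) / 2)) *m X^H).
Proof.
move=> WY x0 y0 pa pb.
(* V is the inverse of the frame Y diag(y^(b/2)), in which the three diagonal
   matrices with exponents a, (a + b)/2 and b become D^2, D and 1. *)
have [V [Z [ZV VY]]] : exists V Z, Z *m V = 1%:M /\
    V *m Y = rdiag (fun j => y j `^ (- (b / 2))).
  exists (rdiag (fun j => y j `^ (- (b / 2))) *m W).
  exists (Y *m rdiag (fun j => y j `^ (b / 2))).
  split; last by rewrite -mulmxA WY mulmx1.
  rewrite mulmxA -(mulmxA Y) rdiagM.
  rewrite (@eq_rdiag _ _ _ (fun=> 1)) => [|j].
    by rewrite rdiag1 mulmx1 (mulmx1C WY).
  by rewrite (@powR_split _ _ _ 0) ?powRr0// subrr.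
have {}VY d e :
    (forall j, y j `^ (- (b / 2)) * d j * y j `^ (- (b / 2)) = e j) ->
    V *m (Y *m rdiag d *m Y^H) *m V^H = rdiag e.
  move=> /eq_rdiag <-.
  by rewrite !mulmxA VY -mulmxA -adjmxM VY adj_rdiag !rdiagM.
(* With T1 = V X diag(x^(a/2)) and T2 = V X diag(x^(b/2)), the terms in [X] become T1 T1^H, T2 T2^H
   and, for the midpoint, T1 T2^H, as in [psdmx_geom_mean]. *)
have VXX p q r : (p + q) / 2 = r ->
    V *m (X *m rdiag (fun j => x j `^ r) *m X^H) *m V^H =
    (V *m X *m rdiag (fun j => x j `^ (p / 2))) *m
    (V *m X *m rdiag (fun j => x j `^ (q / 2)))^H.
  move=> pqr; rewrite mul_rdiag_adj adjmxM !mulmxA.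
  rewrite (@eq_rdiag _ _ (fun j => x j `^ r)
    (fun j => x j `^ (p / 2) * x j `^ (q / 2))) // => j.
  by rewrite (@powR_split _ _ _ r) // -pqr mulrDl.
pose D := rdiag (fun j => y j `^ ((a - b) / 2)).
have ea : (a + a) / 2 = a by lra.
have eb : (b + b) / 2 = b by lra.
have VD : V *m (Y *m rdiag (fun j => y j `^ ((a + b) / 2)) *m Y^H) *m V^H = D.
  apply: VY => j; rewrite (@powR_split _ _ _ (a / 2)) //; last by lra.
  by rewrite (@powR_split _ _ _ ((a - b) / 2))//; lra.
apply: (psdmx_congrB_inv ZV VD (VXX a b _ erefl)).
have VDD : V *m (Y *m rdiag (fun j => y j `^ a) *m Y^H) *m V^H = D *m D.
  rewrite /D rdiagM; apply: VY => j.
  rewrite (@powR_split _ _ _ (a - b / 2)) //; last by lra.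
  by rewrite !(@powR_split _ _ _ (a - b))//; lra.
have V1 : V *m (Y *m rdiag (fun j => y j `^ b) *m Y^H) *m V^H = 1%:M.
  rewrite -rdiag1; apply: VY => j.
  rewrite (@powR_split _ _ _ (b / 2)) //; last by lra.
  by rewrite (@powR_split _ _ _ 0) ?powRr0// subrr.
apply: (psdmx_geom_mean _ _ (psdmx_congrB VDD (VXX _ _ _ ea) pa)
  (psdmx_congrB V1 (VXX _ _ _ eb) pb)).
  by rewrite mul_rdiag_adj; exact: hermsymmx_rdiag.
by apply: psdmx_rdiag => j; exact: powR_ge0.
Qed.

(** For v = Z^H u, the value at u of the form Z diag(x^p) Z^H, as a real function of the
    exponent. *)
Definition pow_form n (x : 'I_n -> R) (v : 'cV[C]_n) (p : R) : R :=
  \sum_j (complex.Re (v j 0) ^+ 2 + complex.Im (v j 0) ^+ 2) * x j `^ p.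

Lemma continuous_pow_form n (x : 'I_n -> R) v :
  (forall j, 0 < x j) -> continuous (pow_form x v).
Proof.
move=> x0; apply: continuous_big => [|j _ p]; first exact: add_continuous.
by apply: cvgMl_tmp; exact: continuous_powRr.
Qed.

(** Gives the matrix inequality the shape that [midpoint_ge0] requires. *)
Lemma psdmx_pow_formP n m (X : 'M[C]_(n, m)) (Y : 'M[C]_n)
    (x : 'I_m -> R) (y : 'I_n -> R) (p : R) :
  psdmx (Y *m rdiag (fun j => y j `^ p) *m Y^H
         - X *m rdiag (fun j => x j `^ p) *m X^H) <->
  forall u, 0 <= pow_form y (Y^H *m u) p - pow_form x (X^H *m u) p.
Proof.
have form k (Z : 'M[C]_(n, k)) z u :
    (u^H *m (Z *m rdiag (fun j => z j `^ p) *m Z^H) *m u) 0 0 =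
    (pow_form z (Z^H *m u) p)%:C.
  rewrite /pow_form -(rdiag_form _ (Z^H *m u)) adjmxM adjmxK.
  by rewrite !mulmxA.
set M := _ - _; have formM u : (u^H *m M *m u) 0 0 =
    (pow_form y (Y^H *m u) p - pow_form x (X^H *m u) p)%:C.
  by rewrite formmxB !form rmorphB.
split=> [/psdmxP[_ pM] u|pM]; first by rewrite -ler0c -formM.
apply/psdmxP; split=> [|u]; last by rewrite formM ler0c.
rewrite /M adjmxB.
by congr (_ - _); apply/hermsymmxP; exact: hermsymmx_rdiag.
Qed.

Lemma psdmx_powR_jensen n m (X : 'M[C]_(n, m)) (Y W : 'M[C]_n)
    (x : 'I_m -> R) (y : 'I_n -> R) (p : R) :
  W *m Y = 1%:M -> (forall j, 0 < x j) -> (forall j, 0 < y j) ->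
  psdmx (Y *m Y^H - X *m X^H) ->
  psdmx (Y *m rdiag y *m Y^H - X *m rdiag x *m X^H) ->
  0 <= p <= 1 ->
  psdmx (Y *m rdiag (fun j => y j `^ p) *m Y^H
         - X *m rdiag (fun j => x j `^ p) *m X^H).
Proof.
move=> WY x0 y0 p0 p1 p01; apply/psdmx_pow_formP.
move: p p01; apply: midpoint_ge0.
- move=> u p; apply: cvgB; exact: continuous_pow_form.
- apply/psdmx_pow_formP; move: p0.
  rewrite (@eq_rdiag _ _ (fun j => y j `^ 0) (fun=> 1)) => [|j];
    last exact: powRr0.
  rewrite (@eq_rdiag _ _ (fun j => x j `^ 0) (fun=> 1)) => [|j];
    last exact: powRr0.
  by rewrite !rdiag1 !mulmx1.
- apply/psdmx_pow_formP; move: p1.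
  rewrite (@eq_rdiag _ _ (fun j => y j `^ 1) y) => [|j]; last exact/powRr1/ltW.
  by rewrite (@eq_rdiag _ _ (fun j => x j `^ 1) x) => [|j];
    last exact/powRr1/ltW.
- move=> a b _ _ /psdmx_pow_formP pa /psdmx_pow_formP pb.
  by apply/psdmx_pow_formP; exact: psdmx_powR_midpoint WY x0 y0 pa pb.
Qed.

End Jensen.

(** * The scalar Young ratio *)

Section Scalar.
Context {R : realType}.

Lemma expR_chord (c L s : R) : 0 < L -> - L <= s <= L ->
  expR (c * s) <= (L + s) / (L *+ 2) * expR (c * L)
                  + (L - s) / (L *+ 2) * expR (- (c * L)).
Proof.
move=> L0 /andP[sL1 sL2]; set p := (L + s) / (L *+ 2).
have L2 : 0 < L *+ 2 by rewrite mulrn_wgt0.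
have p0 : 0 <= p by apply: divr_ge0; lra.
have p1 : p <= 1 by rewrite ler_pdivrMr// mul1r; lra.
have := convex_expR (Itv01 p0 p1) (c * L) (- (c * L)).
rewrite !convRE/= => H.
have -> : (L - s) / (L *+ 2) = 1 - p by rewrite /p; field; rewrite gt_eqF.
have -> // : c * s = p * (c * L) + (1 - p) * - (c * L).
by rewrite /p; field; rewrite gt_eqF.
Qed.

(** Convexity of sinh on the nonnegative axis, with sinh 0 = 0; [midpoint_ge0] reduces it to
    midpoint convexity. *)
Lemma sinh_scale_le (m a : R) : 0 <= m -> 0 <= a <= 1 ->
  expR (a * m) - expR (- (a * m)) <= a * (expR m - expR (- m)).
Proof.
move=> m0 a01; rewrite -subr_ge0.
pose phi (_ : unit) a :=
  a * (expR m - expR (- m)) - (expR (a * m) - expR (- (a * m))).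
suff /(_ a a01 tt) : forall p, 0 <= p <= 1 -> forall i, 0 <= phi i p by [].
move=> {a a01}; apply: midpoint_ge0 => [i|i|i|].
- move=> x; apply: cvgB; first exact: mulrr_continuous.
  apply: cvgB; apply: continuous_comp; try exact: continuous_expR.
    exact: mulrr_continuous.
  by apply: cvgN; exact: mulrr_continuous.
- by rewrite /phi !mul0r oppr0 expR0 !subrr.
- by rewrite /phi !mul1r subrr.
move=> a b /andP[a0 _] /andP[b0 _] pa pb i.
move: (pa tt) (pb tt); rewrite /phi.
(* [u] and [v] express sinh(am) + sinh(bm) = 2 sinh((a + b)m/2) cosh((a - b)m/2), whose last factor
   is at least 1. *)
set S := expR m - _; set u := expR ((a + b) / 2 * m).
pose v := expR ((a - b) / 2 * m).
have u1 : 1 <= u by rewrite -expR0 ler_expR mulr_ge0// divr_ge0// addr_ge0.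
have v0 : 0 < v by exact: expR_gt0.
have ea : expR (a * m) = u * v by rewrite -expRD; congr expR; field.
have eb : expR (b * m) = u / v by rewrite -expRN -expRD; congr expR; field.
rewrite !expRN ea eb.
have u0 : 0 < u by exact: lt_le_trans u1.
have uV : 0 <= u - u^-1 by rewrite subr_ge0 (le_trans _ u1)// invf_le1.
have : 0 <= (u - u^-1) * (v + v^-1 - 2).
  apply: mulr_ge0 => //; have -> : v + v^-1 - 2 = (v - 1) ^+ 2 / v.
    by field; rewrite gt_eqF.
  by rewrite divr_ge0 ?sqr_ge0// ltW.
rewrite !invfM invrK; nra.
Qed.


(** The quotient of the arithmetic by the geometric mean of positive a and b, with weight [w] on b,
    as a function of s = ln(b/a). *)
Definition young_ratio (w s : R) : R :=
  (1 - w) * expR (- (w * s)) + w * expR ((1 - w) * s).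

(** Exchanging a and b changes the sign of s and exchanges the weights. *)
Lemma young_ratio_sym w s : young_ratio w (- s) = young_ratio (1 - w) s.
Proof.
by rewrite /young_ratio addrC; congr (_ * expR _ + _ * expR _); ring.
Qed.

(** The right side minus the left is 2 (t sinh((1 - t)L) - (1 - t) sinh(tL)), so [sinh_scale_le]
    applies with the factor t/(1 - t). *)
Lemma young_ratio_compl_le t L : 0 <= t <= 1 - t -> 0 <= L ->
  young_ratio (1 - t) L <= young_ratio t L.
Proof.
move=> /andP[t0 t1] L0; have q0 : 0 < 1 - t by lra.
have := @sinh_scale_le ((1 - t) * L) (t / (1 - t)).
rewrite mulr_ge0// ?(ltW q0)// divr_ge0 ?(ltW q0)//= ler_pdivrMr// mul1r t1.
move=> /(_ isT isT); rewrite mulrA divfK ?gt_eqF// mulrAC ler_pdivlMr//.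
have -> : young_ratio (1 - t) L =
    t * expR (- ((1 - t) * L)) + (1 - t) * expR (t * L).
  by rewrite /young_ratio; congr (_ * _ + _ * expR _); ring.
by rewrite /young_ratio; lra.
Qed.

(** Convexity in [s] bounds the ratio by its values at -L and L, which by symmetry are those at L
    for the weights 1 - w and w; the smaller weight gives the larger value. *)
Lemma young_ratio_le w s L : 0 < L -> - L <= s <= L -> 0 <= w <= 1 ->
  young_ratio w s <= young_ratio (Num.min w (1 - w)) L.
Proof.
move=> L0 sL /andP[w0 w1].
have [wL wNL] : young_ratio w L <= young_ratio (Num.min w (1 - w)) L /\
    young_ratio w (- L) <= young_ratio (Num.min w (1 - w)) L.
  rewrite young_ratio_sym; have [ww|/ltW ww] := leP w (1 - w).
    by split => //; apply: young_ratio_compl_le; rewrite ?ww ?w0// ltW.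
  split => //; rewrite -{1}[w](subKr 1).
  by apply: young_ratio_compl_le; rewrite ?subKr ?ww ?subr_ge0// ?w1// ltW.
have L2 : 0 < L *+ 2 by rewrite mulrn_wgt0.
set p := (L + s) / (L *+ 2); have p0 : 0 <= p by apply: divr_ge0; lra.
have pE : (L - s) / (L *+ 2) = 1 - p by rewrite /p; field; rewrite gt_eqF.
have p1 : 0 <= 1 - p by rewrite -pE; apply: divr_ge0; lra.
have c1 := expR_chord (- w) L0 sL; have c2 := expR_chord (1 - w) L0 sL.
have w1' : 0 <= 1 - w by lra.
have := lerD (ler_wpM2l w1' c1) (ler_wpM2l w0 c2).
move: wL wNL; rewrite -/p pE /young_ratio !mulNr !mulrN !opprK.
set e1 := expR (- (w * L)); set e2 := expR _; set e3 := expR (w * L).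
nra.
Qed.

End Scalar.

(** * Simultaneous diagonalization by congruence *)

Section Frames.
Context {R : realType}.
Local Notation C := R[i].

Lemma posdefmxP n (A : 'M[C]_n) :
  posdefmx A <-> A^H = A /\ forall u : 'cV_n, u != 0 -> 0 < (u^H *m A *m u) 0 0.
Proof.
split=> -[hA pA]; split; do ?[exact/hermsymmxP].
  by move=> u; have := pA u; rewrite adjmx.unlock.
by move=> u; have := pA u; rewrite adjmx.unlock.
Qed.

Lemma posdefmx_congr n (X W A : 'M[C]_n) :
  X *m W = 1%:M -> posdefmx A -> posdefmx (X *m A *m X^H).
Proof.
move=> XW /posdefmxP[hA pA]; apply/posdefmxP; split=> [|u u0].
  by rewrite !adjmxM adjmxK hA mulmxA.
have := pA (X^H *m u); rewrite adjmxM adjmxK !mulmxA; apply.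
apply: contra u0 => /eqP Xu0; apply/eqP.
by rewrite -[u]mul1mx -adjmx1 -XW adjmxM -mulmxA Xu0 mulmx0.
Qed.

Lemma posdefmx_rdiag_gt0 n (d : 'I_n -> R) j : posdefmx (rdiag d) -> 0 < d j.
Proof.
move=> /posdefmxP[_ /(_ (delta_mx j 0))]; rewrite rdiag_form (ltcR 0).
rewrite (bigD1 j)//= big1 => [|i /negPf ij]; last first.
  by rewrite !mxE ij/= expr0n/= addr0 mul0r.
rewrite !mxE !eqxx/= expr1n expr0n/= !addr0 mul1r; apply.
by apply/eqP => /matrixP/(_ j 0)/eqP; rewrite !mxE !eqxx oner_eq0.
Qed.

Lemma posdefmx_spectral n (A : 'M[C]_n) : posdefmx A ->
  exists (P : 'M[C]_n) (d : 'I_n -> R),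
    [/\ P *m P^H = 1%:M, forall j, 0 < d j, A = P^H *m rdiag d *m P &
    forall p, powmx A p = P^H *m rdiag (fun j => d j `^ p) *m P].
Proof.
move=> pA; have [/spectral_rdiag[PP invP AE] _] := pA.
set d := fun j => complex.Re (spectral_diag A 0 j) in AE.
exists (spectralmx A), d.
have powE p : powmx A p = (spectralmx A)^H *m
    rdiag (fun j => d j `^ p) *m spectralmx A.
  rewrite /powmx invP rdiag.unlock.
  suff -> : map_mx (fun z => (complex.Re z `^ p)%:C) (spectral_diag A) =
    \row_j (d j `^ p)%:C by [].
  by apply/rowP => j; rewrite !mxE.
split=> // j; apply: (@posdefmx_rdiag_gt0 _ d); clear powE invP.
(* [spectralmx A] itself contains [A]; generalizing it confines [rewrite AE] to the [A] inside the
   congruence. *)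
move: (spectralmx A) d PP AE => P d PP AE.
have := posdefmx_congr PP pA; rewrite AE !mulmxA PP mul1mx.
by rewrite -mulmxA PP mulmx1.
Qed.

(** With A^(-1/2) B A^(-1/2) = Q^H diag(x) Q, take X = A^(1/2) Q^H and W = Q A^(-1/2). The same
    frame serves all exponents [s]. *)
Lemma posdefmx_frame n (A B : 'M[C]_n) : posdefmx A -> posdefmx B ->
  exists (X W : 'M[C]_n) (x : 'I_n -> R),
    [/\ W *m X = 1%:M, forall j, 0 < x j, A = X *m X^H,
      B = X *m rdiag x *m X^H &
    forall s, gmeanmx A B s = X *m rdiag (fun j => x j `^ s) *m X^H].
Proof.
move=> pA pB; have [P [d [PP d0 AE powE]]] := posdefmx_spectral pA.
have PP' := mulmx1C PP.
have powM p q : powmx A p *m powmx A q =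
    P^H *m rdiag (fun j => d j `^ (p + q)) *m P.
  rewrite !powE -!mulmxA [P *m (_ *m _)]mulmxA PP mul1mx.
  rewrite [rdiag _ *m (_ *m _)]mulmxA rdiagM.
  by rewrite (@eq_rdiag _ _ _ (fun j => d j `^ (p + q))) => [|j];
    last exact: powR_split.
have pow_adj p : (powmx A p)^H = powmx A p.
  by rewrite powE !adjmxM adj_rdiag adjmxK mulmxA.
have pow1 p : powmx A p *m powmx A (- p) = 1%:M.
  rewrite powM (@eq_rdiag _ _ _ (fun=> 1)) => [|j];
    last by rewrite subrr powRr0.
  by rewrite rdiag1 mulmx1.
have powA : powmx A 2^-1 *m powmx A 2^-1 = A.
  rewrite powM (@eq_rdiag _ _ _ d) => [|j]; first by rewrite -AE.
  have -> : 2^-1 + 2^-1 = 1 :> R by field.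
  by rewrite powRr1// ltW.
(* From here on the two roots are just Hermitian [S] and [T], inverse to each other, with S^2 =
   A. *)
rewrite /gmeanmx; move: (powmx A 2^-1) (powmx A (- 2^-1)) (pow_adj 2^-1)
  (pow_adj (- 2^-1)) (pow1 2^-1) powA => S T hS hT ST SS.
have TS := mulmx1C ST.
have pN : posdefmx (T *m B *m T) by have := posdefmx_congr TS pB; rewrite hT.
have [Q [x [QQ x0 NE NpowE]]] := posdefmx_spectral pN.
have XX e : (S *m Q^H) *m rdiag e *m (S *m Q^H)^H =
    S *m (Q^H *m rdiag e *m Q) *m S.
  by rewrite adjmxM hS adjmxK !mulmxA.
exists (S *m Q^H), (Q *m T), x; split=> //.
- by rewrite mulmxA -(mulmxA Q) TS mulmx1.
- by rewrite adjmxM hS adjmxK mulmxA -(mulmxA S) (mulmx1C QQ) mulmx1.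
- by rewrite XX -NE !mulmxA ST mul1mx -mulmxA TS mulmx1.
- by move=> s; rewrite XX NpowE.
Qed.

Lemma psdmx_trans n (A B D : 'M[C]_n) :
  psdmx (A - B) -> psdmx (B - D) -> psdmx (A - D).
Proof. by move=> AB BD; have := psdmxD AB BD; rewrite addrA subrK. Qed.

Lemma psdmx_subZ n (c : R) (A B : 'M[C]_n) :
  0 <= c -> psdmx (A - B) -> psdmx (c%:C *: A - c%:C *: B).
Proof. by move=> c0 /(psdmxZ c0); rewrite scalerBr. Qed.

Lemma psdmx_subD2r n (A B D : 'M[C]_n) :
  psdmx (A - B) -> psdmx ((A + D) - (B + D)).
Proof. by rewrite opprD addrACA subrr addr0. Qed.

Lemma psdmx_sub_rdiag m n (X : 'M[C]_(m, n)) (d e : 'I_n -> R) :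
  (forall j, d j <= e j) ->
  psdmx (X *m rdiag e *m X^H - X *m rdiag d *m X^H).
Proof.
move=> de; apply: (psdmx_congrB erefl erefl).
have := @psdmx_rdiag R n (fun j => e j + -1 * d j).
rewrite -rdiagD -rdiagZ rmorphN1 scaleN1r; apply=> j.
by rewrite mulN1r subr_ge0.
Qed.

Lemma psdmx_sub_rdiag_le n (Y W : 'M[C]_n) (d e : 'I_n -> R) j :
  W *m Y = 1%:M ->
  psdmx (Y *m rdiag e *m Y^H - Y *m rdiag d *m Y^H) -> d j <= e j.
Proof.
move=> WY /(psdmx_congrB_inv WY erefl erefl) p; rewrite -subr_ge0.
apply: (@psdmx_rdiag_ge0 _ _ (fun j => e j - d j)).
rewrite (@eq_rdiag _ _ _ (fun j => e j + -1 * d j)) => [|i].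
  by rewrite -rdiagD -rdiagZ rmorphN1 scaleN1r.
by rewrite mulN1r.
Qed.

(** Placing frames side by side adds the matrices they represent, which provides rectangular frames
    for sums. *)
Lemma row_mx_rdiag m n1 n2 (X : 'M[C]_(m, n1)) (Z : 'M[C]_(m, n2))
    (d : 'I_(n1 + n2) -> R) :
  row_mx X Z *m rdiag d *m (row_mx X Z)^H =
  X *m rdiag (fun j => d (lshift n2 j)) *m X^H
  + Z *m rdiag (fun j => d (rshift n1 j)) *m Z^H.
Proof.
rewrite adjmx.unlock rdiag.unlock; apply/matrixP => i k.
rewrite !mul_mx_diag !mxE big_split_ord /=.
apply: (congr2 +%R); apply: eq_bigr => j _; rewrite !mxE.
  by rewrite (unsplitK (inl j)).
by rewrite (unsplitK (inr j)).
Qed.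

Lemma invmx_eq n (M N : 'M[C]_n) : M *m N = 1%:M -> invmx M = N.
Proof.
move=> MN; have [Mu _] := mulmx1_unit MN.
by rewrite -[invmx M]mulmx1 -MN mulKmx.
Qed.

(** The inverse is diagonal in the dual frame [W^H]; the double adjoint keeps the shape Z diag(e)
    Z^H. *)
Lemma invmx_congr_rdiag n (Y W : 'M[C]_n) (d : 'I_n -> R) :
  W *m Y = 1%:M -> (forall j, d j != 0) ->
  invmx (Y *m rdiag d *m Y^H) = W^H *m rdiag (fun j => (d j)^-1) *m (W^H)^H.
Proof.
move=> WY d0; apply: invmx_eq; rewrite adjmxK -!mulmxA.
have YW : Y^H *m W^H = 1%:M by rewrite -adjmxM WY adjmx1.
rewrite [Y^H *m (_ *m _)]mulmxA YW mul1mx [rdiag d *m (_ *m _)]mulmxA rdiagM.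
rewrite (@eq_rdiag _ _ _ (fun=> 1)) => [|j]; last by rewrite divff.
by rewrite rdiag1 mul1mx (mulmx1C WY).
Qed.

End Frames.

(** * Geometric and harmonic means *)

Section MatrixMeans.
Context {R : realType}.
Local Notation C := R[i].

Lemma posdefmxD n (A B : 'M[C]_n) : posdefmx A -> psdmx B -> posdefmx (A + B).
Proof.
move=> /posdefmxP[hA pA] /psdmxP[hB pB]; apply/posdefmxP.
split=> [|u u0]; first by rewrite adjmxD hA hB.
by rewrite mulmxDr mulmxDl mxE ltr_pwDl ?pA.
Qed.

Lemma posdefmx_scalar n (c : R) : 0 < c -> posdefmx (c%:C%:M : 'M[C]_n).
Proof.
move=> c0; apply/posdefmxP; split=> [|u u0]; first exact: adjmx_scalar.
by rewrite mul_mx_scalar -scalemxAl mxE mulr_gt0 ?(ltcR 0)// form1_gt0.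
Qed.

Lemma psdmx_posdefmx n (A : 'M[C]_n) : posdefmx A -> psdmx A.
Proof.
move=> /posdefmxP[hA pA]; apply/psdmxP; split=> // u.
by have [->|/pA/ltW//] := eqVneq u 0; rewrite mulmx0 mxE.
Qed.

(** Side by side, [X1] and [X2] form a frame for both sums, in which the exponent [s] yields the sum
    of the two means; [psdmx_powR_jensen] compares it with the square frame [Y]. *)
Lemma gmeanmx_superadditive n (A1 B1 A2 B2 : 'M[C]_n) (s : R) :
  posdefmx A1 -> posdefmx B1 -> posdefmx A2 -> posdefmx B2 -> 0 <= s <= 1 ->
  psdmx (gmeanmx (A1 + A2) (B1 + B2) s - (gmeanmx A1 B1 s + gmeanmx A2 B2 s)).
Proof.
move=> pA1 pB1 pA2 pB2 s01.
have [X1 [_ [x1 [_ x10 A1E B1E ->]]]] := posdefmx_frame pA1 pB1.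
have [X2 [_ [x2 [_ x20 A2E B2E ->]]]] := posdefmx_frame pA2 pB2.
have [Y [W [y [WY y0 AE BE ->]]]] := posdefmx_frame
  (posdefmxD pA1 (psdmx_posdefmx pA2)) (posdefmxD pB1 (psdmx_posdefmx pB2)).
pose x k := match split k with inl i => x1 i | inr j => x2 j end.
have x0 k : 0 < x k by rewrite /x; case: split.
have xl i : x (lshift n i) = x1 i by rewrite /x (unsplitK (inl i)).
have xr i : x (rshift n i) = x2 i by rewrite /x (unsplitK (inr i)).
have XX : row_mx X1 X2 *m (row_mx X1 X2)^H = Y *m Y^H.
  have := row_mx_rdiag X1 X2 (fun=> 1).
  by rewrite !rdiag1 !mulmx1 -AE A1E A2E.
have XxX : row_mx X1 X2 *m rdiag x *m (row_mx X1 X2)^H = Y *m rdiag y *m Y^H.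
  by rewrite -BE B1E B2E row_mx_rdiag (eq_rdiag xl) (eq_rdiag xr).
have psd0 : psdmx (0 : 'M[C]_n).
  by have := psdmx_gram (0 : 'M[C]_n); rewrite mul0mx.
have := @psdmx_powR_jensen _ _ _ (row_mx X1 X2) Y W x y s WY x0 y0.
rewrite XX XxX !subrr => /(_ psd0 psd0 s01); rewrite row_mx_rdiag.
rewrite (@eq_rdiag _ _ (fun j => x (lshift n j) `^ s)
  (fun j => x1 j `^ s)) => [|j]; last by rewrite xl.
by rewrite (@eq_rdiag _ _ (fun j => x (rshift n j) `^ s)
  (fun j => x2 j `^ s)) => [|j]; last by rewrite xr.
Qed.

(** Here X X^H = X diag(x) X^H with [X] invertible, which forces x = 1. *)
Lemma gmeanmx_scalar n (c s : R) : 0 < c ->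
  gmeanmx (c%:C%:M) (c%:C%:M) s = c%:C%:M :> 'M[C]_n.
Proof.
move=> c0; have pc := @posdefmx_scalar n c c0.
have [X [W [x [WX x0 cE cxE ->]]]] := posdefmx_frame pc pc.
suff x1 j : x j = 1.
  rewrite (@eq_rdiag _ _ _ (fun=> 1)) => [|j]; last by rewrite x1 powR1.
  by rewrite rdiag1 mulmx1 -cE.
have rx : rdiag x = 1%:M.
  have XW : X^H *m W^H = 1%:M by rewrite -adjmxM WX adjmx1.
  move: (etrans (esym cxE) cE) => /(congr1 (fun M => W *m M *m W^H)).
  by rewrite -!mulmxA XW !mulmx1 !mulmxA WX mul1mx.
move: rx => /matrixP/(_ j j); rewrite rdiag.unlock !mxE eqxx !mulr1n.
exact: complexI.
Qed.

Lemma gmeanmx_add_scalar n (A B : 'M[C]_n) (c s : R) :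
  posdefmx A -> posdefmx B -> 0 < c -> 0 <= s <= 1 ->
  psdmx (gmeanmx (A + c%:C%:M) (B + c%:C%:M) s - (gmeanmx A B s + c%:C%:M)).
Proof.
move=> pA pB c0; have pc := @posdefmx_scalar n c c0.
move=> /(gmeanmx_superadditive pA pB pc pc).
by rewrite (gmeanmx_scalar n s c0).
Qed.

Lemma ln_in_itv (r y : R) : 0 < y -> 0 < r -> 1 <= r * y -> y <= r ->
  - ln r <= ln y <= ln r.
Proof.
move=> y0 r0 ry yr; rewrite ler_ln ?posrE// yr andbT -lnV ?posrE//.
by rewrite ler_ln ?posrE ?invr_gt0// -div1r ler_pdivrMr// mulrC.
Qed.

(** The quotient of the geometric by the harmonic mean of 1 and y is that of the arithmetic by the
    geometric mean of 1 and 1/y, whence the argument -ln y. *)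
Lemma young_ratio_powR (w y : R) : 0 < y ->
  y `^ w * ((1 - w) + w / y) = young_ratio w (- ln y).
Proof.
move=> y0; rewrite /young_ratio mulrDr mulrCA -powR_inv1 ?ltW//.
rewrite -powRD ?(gt_eqF y0) ?implybT// {1 2}/powR !gt_eqF// mulrC.
by congr (_ * expR _ + _ * expR _); ring.
Qed.

Lemma young_ratio_gt0 (w s : R) : 0 <= w <= 1 -> 0 < young_ratio w s.
Proof.
move=> /andP[w0 w1]; rewrite /young_ratio.
have := expR_gt0 (- (w * s)); have := expR_gt0 ((1 - w) * s).
set a := expR _; set b := expR _ => a0 b0.
by have [->|w'] := eqVneq w 0; nra.
Qed.

Lemma amean_gmean_ratio (a b t : R) : 0 < a -> 0 < b ->
  amean a b t / gmean a b t = young_ratio t (ln (b / a)).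
Proof.
move=> a0 b0; rewrite /gmean /amean /powR !gt_eqF// ln_div ?posrE//.
rewrite -{1}(lnK a0) -{1}(lnK b0) -expRD -expRN mulrDl -!mulrA -!expRD.
by rewrite /young_ratio; congr (_ * expR _ + _ * expR _); ring.
Qed.

Lemma harmonic_ge_gmeanmx n (A B : 'M[C]_n) (l u w : R) :
  posdefmx A -> posdefmx B -> 0 < l -> l < u ->
  psdmx (A - l%:C%:M) -> psdmx (u%:C%:M - A) ->
  psdmx (B - l%:C%:M) -> psdmx (u%:C%:M - B) -> 0 <= w <= 1 ->
  psdmx (invmx ((1 - w)%:C *: invmx A + w%:C *: invmx B)
    - (young_ratio (Num.min w (1 - w)) (ln (u / l)))^-1%:C *: gmeanmx A B w).
Proof.
move=> pA pB l0 lu lA Au lB Bu w01; set r := u / l; set q := young_ratio _ _.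
have r1 : 1 < r by rewrite ltr_pdivlMr// mul1r.
have r0 : 0 < r by exact: lt_trans r1.
(* N <= u = r l <= r M. Used both ways this gives B <= r A and A <= r B, so that 1/r <= y j <= r. *)
have ratio (M N : 'M[C]_n) : psdmx (M - l%:C%:M) -> psdmx (u%:C%:M - N) ->
    psdmx (r%:C *: M - N).
  move=> lM; apply: psdmx_trans; have := psdmx_subZ (ltW r0) lM.
  by rewrite scale_scalar_mx -rmorphM divfK ?gt_eqF.
have BA := ratio _ _ lA Bu; have AB := ratio _ _ lB Au.
have [Y [W [y [WY y0 AE BE ->]]]] := posdefmx_frame pA pB.
have AE1 : A = Y *m rdiag (fun=> 1) *m Y^H by rewrite rdiag1 mulmx1.
have scale (Z : 'M[C]_n) c d : c%:C *: (Z *m rdiag d *m Z^H) =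
    Z *m rdiag (fun j => c * d j) *m Z^H.
  by rewrite -rdiagZ -scalemxAr -scalemxAl.
have yr j : y j <= r.
  move: BA; rewrite AE1 BE scale => /(psdmx_sub_rdiag_le j WY).
  by rewrite mulr1.
have ry j : 1 <= r * y j.
  by move: AB; rewrite AE1 BE scale => /(psdmx_sub_rdiag_le j WY).
have [w0 w1] := andP w01.
have e0 j : 0 < (1 - w) + w / y j.
  have := y0 j; rewrite -invr_gt0; set z := (y j)^-1 => z0.
  by have [->|w'] := eqVneq w 0; nra.
have -> : invmx ((1 - w)%:C *: invmx A + w%:C *: invmx B) =
    Y *m rdiag (fun j => ((1 - w) + w / y j)^-1) *m Y^H.
  rewrite {1}AE1 {1}BE !(invmx_congr_rdiag WY) => [|j|j]; last 2 first.
  - by rewrite gt_eqF.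
  - exact: oner_neq0.
  rewrite !scale -mulmxDl -mulmxDr rdiagD.
  rewrite (@eq_rdiag _ _ _ (fun j => (1 - w) + w / y j)) => [|j]; last first.
    by rewrite invr1 mulr1.
  (* The sum of the inverses is diagonal in the frame [W^H]; inverting it returns to the frame
     [Y]. *)
  have YW : Y^H *m W^H = 1%:M by rewrite -adjmxM WY adjmx1.
  by rewrite (invmx_congr_rdiag YW) ?adjmxK// => j; rewrite gt_eqF.
rewrite scale; apply: psdmx_sub_rdiag => j.
have q0 : 0 < q.
  by apply: young_ratio_gt0; rewrite le_min ge_min w0 w1 subr_ge0 w1.
rewrite ler_pdivrMl// ler_pdivlMr// young_ratio_powR//.
apply: young_ratio_le => //; first by rewrite ln_gt0.
by rewrite lerN2 lerNl andbC ln_in_itv.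
Qed.

End MatrixMeans.

(** * The resolvent average against the shifted geometric mean *)

Unset Implicit Arguments.
Set Strict Implicit.

Theorem theorem3p4 (R : realType) (n : nat) (A B : 'M[R[i]]_n)
    (h k mu lambda : R)
    (A_pos : posdefmx A) (B_pos : posdefmx B)
    (h_gt0 : 0 < h) (h_lt_k : h < k)
    (hA : loewner_ge A h%:C%:M) (Ak : loewner_ge k%:C%:M A)
    (hB : loewner_ge B h%:C%:M) (Bk : loewner_ge k%:C%:M B)
    (mu_gt0 : 0 < mu) (lambda_ge0 : 0 <= lambda) (lambda_le1 : lambda <= 1) :
  let t := Num.min lambda (1 - lambda) in
  let kstar := (k + mu)^-1 in
  let hstar := (h + mu)^-1 in
  let C := (amean kstar hstar t / gmean kstar hstar t)^-1 in
  loewner_ge (resolvent_avg mu A B (1 - lambda) lambda + mu%:C%:M)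
             (C%:C *: (gmeanmx A B lambda + mu%:C%:M)).
Proof.
move=> t kstar hstar C.
have hmu0 : 0 < h + mu by lra.
have kmu0 : 0 < k + mu by lra.
have psd_ge (M : 'M[R[i]]_n) : psdmx (M - h%:C%:M) ->
    psdmx (M + mu%:C%:M - (h + mu)%:C%:M).
  by move=> /(psdmx_subD2r mu%:C%:M); rewrite -raddfD -rmorphD.
have psd_le (M : 'M[R[i]]_n) : psdmx (k%:C%:M - M) ->
    psdmx ((k + mu)%:C%:M - (M + mu%:C%:M)).
  by move=> /(psdmx_subD2r mu%:C%:M); rewrite -raddfD -rmorphD.
have mu_pos := posdefmx_scalar n mu_gt0.
have pA := posdefmxD A_pos (psdmx_posdefmx mu_pos).
have pB := posdefmxD B_pos (psdmx_posdefmx mu_pos).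
have l01 : 0 <= lambda <= 1 by rewrite lambda_ge0.
have t01 : 0 <= t <= 1.
  by rewrite /t le_min ge_min lambda_ge0 lambda_le1 subr_ge0 lambda_le1.
(* As hstar / kstar = (k + mu)/(h + mu), 1/C is the extremal Young ratio for the spectral bounds h +
   mu and k + mu. *)
have CE : C = (young_ratio t (ln ((k + mu) / (h + mu))))^-1.
  rewrite /C amean_gmean_ratio ?invr_gt0//.
  by rewrite /hstar /kstar invrK mulrC.
have C0 : 0 <= C by rewrite CE invr_ge0 ltW// young_ratio_gt0.
(* Adding mu back leaves the harmonic mean of A + mu and B + mu, to be compared with C times their
   geometric mean. *)
rewrite /loewner_ge /resolvent_avg subrK.
apply: (psdmx_trans _ (psdmx_subZ C0
  (gmeanmx_add_scalar A_pos B_pos mu_gt0 l01))).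
have hk : h + mu < k + mu by rewrite ltrD2r.
rewrite CE.
exact: (harmonic_ge_gmeanmx pA pB hmu0 hk (psd_ge _ hA) (psd_le _ Ak)
  (psd_ge _ hB) (psd_le _ Bk) l01).
Qed.
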